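(* Let $k$ be a field of characteristic zero, $n\geq 1$, $S=k[x_1,\ldots,x_n]$, and let $(S,L)$ be a triangularizable Lie–Rinehart algebra with universal enveloping algebra $U$. Then there is an isomorphism of $k$-vector spaces $\mathrm{HH}^0(U)\cong k$; that is, the center of $U$ is $k$.
   Context: A Lie–Rinehart algebra $(S,L)$ consists of a commutative $k$-algebra $S$, a $k$-Lie algebra $L$ with a left $S$-module structure and a Lie algebra map $L\to\operatorname{Der}(S)$, $\alpha\mapsto\alpha_S$, such that $(s\alpha)_S(t)=s\alpha_S(t)$ and $[\alpha,s\beta]=s[\alpha,\beta]+\alpha_S(s)\beta$ for $s,t\in S$, $\alpha,\beta\in L$. If $L\subseteq \operatorname{Der}(S)$ is simultaneously an $S$-submodule and a Lie subalgebra, then $(S,L)$ is a Lie–Rinehart algebra with $\alpha_S=\alpha$. Its universal enveloping algebra $U$ is the associative algebra equipped with an algebra map $i:S\to U$ and a Lie algebra map $j:L\to U$ satisfying $i(s)j(\alpha)=j(s\alpha)$ and $j(\alpha)i(s)-i(s)j(\alpha)=i(\alpha_S(s))$, universal with these properties. $(S,L)$ with $S=k[x_1,\ldots,x_n]$ and $L\subseteq\operatorname{Der}(S)$ is called triangularizable if $L$ is a free $S$-module with a basis $\alpha_1,\ldots,\alpha_n$ of derivations satisfying $\alpha_i(x_j)=0$ whenever $i>j$ and $\alpha_1(x_1)\cdots\alpha_n(x_n)\neq 0$. $\mathrm{HH}^0(U)=\operatorname{Ext}^0_{U\otimes U^{op}}(U,U)$ is the zeroth Hochschild cohomology, which is the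 center of $U$. *)

(* Defs.v *)
From HB Require Import structures.
From mathcomp Require Import all_boot all_order all_algebra.
From mathcomp Require Export mpoly.
Set Implicit Arguments. Unset Strict Implicit. Unset Printing Implicit Defensive.
Import Order.TTheory GRing.Theory.
Local Open Scope ring_scope.

Section LR.
Variables (k : fieldType) (n : nat).
Local Notation S := {mpoly k[n]}.

Definition is_derivation (D : S -> S) : Prop :=
  (forall (c : k) (p q : S), D (c *: p + q) = c *: D p + D q) /\
  (forall p q : S, D (p * q) = p * D q + D p * q).

Definition der_bracket (D E : S -> S) : S -> S := fun p => D (E p) - E (D p).

Definition der_smul (s : S) (D : S -> S) : S -> S := fun t => s * D t.

Definition in_span (alpha : 'I_n -> S -> S) (D : S -> S) : Prop :=
  exists s : 'I_n -> S, D = fun t => \sum_(i < n) s i * alpha i t.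

(** (S, L) with L = S-span of alpha inside Der(S) is a triangularizable
    Lie-Rinehart algebra (with basis alpha). *)
Definition triangularizable (alpha : 'I_n -> S -> S) : Prop :=
  [/\ (forall i, is_derivation (alpha i)),
      (forall D E, in_span alpha D -> in_span alpha E ->
                   in_span alpha (der_bracket D E)),
      (forall s : 'I_n -> S,
          (fun t => \sum_(i < n) s i * alpha i t) = (fun _ => 0) ->
          forall i, s i = 0),
      (forall i j : 'I_n, (j < i)%N -> alpha i 'X_j = 0) &
      \prod_(i < n) alpha i 'X_i != 0].

Definition is_kalg_mor (B A : algType k) (f : B -> A) : Prop :=
  [/\ forall (c : k) (p q : B), f (c *: p + q) = c *: f p + f q,
      forall p q : B, f (p * q) = f p * f q &
      f 1 = 1].
Definition LR_compatible (alpha : 'I_n -> S -> S) (A : algType k)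
    (f : S -> A) (g : (S -> S) -> A) : Prop :=
  [/\ is_kalg_mor f,
      (forall (c : k) D E, in_span alpha D -> in_span alpha E ->
          g (fun t => c *: D t + E t) = c *: g D + g E),
      (forall D E, in_span alpha D -> in_span alpha E ->
          g (der_bracket D E) = g D * g E - g E * g D),
      (forall s D, in_span alpha D -> f s * g D = g (der_smul s D)) &
      (forall s D, in_span alpha D -> g D * f s - f s * g D = f (D s))].

Definition is_enveloping_algebra (alpha : 'I_n -> S -> S) (U : algType k)
    (i : S -> U) (j : (S -> S) -> U) : Prop :=
  LR_compatible alpha i j /\
  forall (A : algType k) (f : S -> A) (g : (S -> S) -> A),
    LR_compatible alpha f g ->
    (exists h : U -> A, [/\ is_kalg_mor h, (forall s, h (i s) = f s) &
        (forall D, in_span alpha D -> h (j D) = g D)]) /\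
    (forall h1 h2 : U -> A,
        is_kalg_mor h1 -> (forall s, h1 (i s) = f s) ->
        (forall D, in_span alpha D -> h1 (j D) = g D) ->
        is_kalg_mor h2 -> (forall s, h2 (i s) = f s) ->
        (forall D, in_span alpha D -> h2 (j D) = g D) ->
        h1 =1 h2).
End LR.

(* Main.v *)
Require Import Defs.
From HB Require Import structures.
From mathcomp Require Import all_boot all_order all_algebra.
From mathcomp Require Import boolp.
From mathcomp Require Import mpoly.
Set Implicit Arguments. Unset Strict Implicit. Unset Printing Implicit Defensive.
Import GRing.Theory.
Local Open Scope ring_scope.

(** Write [S = k[x_1..x_n]].  [U] acts on [S[xi_1..xi_n]], thought of as
    [S * exp (sum_l xi_l x_l)]: [s] acts by multiplication and a derivation [D] by
    [sum_l D(x_l) (d/dx_l + xi_l)].  The map [u |-> u . 1] sends a normally ordered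
    element [sum_m s_m alpha^m] of order [d] to a polynomial of degree at most [d]
    in [xi] whose degree [d] part is obtained from [sum_m s_m X^m] by substituting
    for [X_r] the linear form [sum_l alpha_r(x_l) xi_l].  The matrix of these forms is
    triangular with nonzero determinant, so the degree [d] part does not vanish.
    On the other hand [d/dxi_l (u . 1) = [u, x_l] . 1], so if [u] commutes with the
    [x_l] then [u . 1] has degree [0] in characteristic [0]; as every element of
    [U] can be normally ordered, such a [u] lies in [S].  If it also
    commutes with the [alpha_r], all its partial derivatives vanish. *)

(** * Endomorphisms and subalgebras *)

Section LinearEndomorphisms.
Variables (k : fieldType) (V : lalgType k).

(** The endomorphism algebra is the target of the universal property when [U] is made to act. The
    space [V] has a unit so that the identity map is visibly nonzero, as an [algType] requires. *)
Record lend := LEnd { lend_fun :> V -> V; lend_linear : linear lend_fun }.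

HB.instance Definition _ := gen_eqMixin lend.
HB.instance Definition _ := gen_choiceMixin lend.
HB.instance Definition _ (f : lend) :=
  GRing.isLinear.Build k V V _ (lend_fun f) (lend_linear f).

Lemma lendP (f g : lend) : f =1 g -> f = g.
Proof.
case: f g => f lf [g lg] /= /funext fg; rewrite fg in lf *.
by congr LEnd; apply: Prop_irrelevance.
Qed.

Lemma lend0_linear : linear (fun _ : V => 0 : V).
Proof. by move=> c u v; rewrite scaler0 addr0. Qed.

Lemma lend_opp_linear (f : lend) : linear (fun v => - f v).
Proof. by move=> c u v; rewrite linearP opprD scalerN. Qed.

Lemma lend_add_linear (f g : lend) : linear (fun v => f v + g v).
Proof. by move=> c u v; rewrite !linearP scalerDr addrACA. Qed.

Lemma lend_scale_linear (a : k) (f : lend) : linear (fun v => a *: f v).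
Proof. by move=> c u v; rewrite linearP scalerDr !scalerA mulrC. Qed.

Lemma lend1_linear : linear (fun v : V => v).
Proof. by []. Qed.

Lemma lend_mul_linear (f g : lend) : linear (fun v => f (g v)).
Proof. by move=> c u v; rewrite !linearP. Qed.

Definition lend0 := LEnd lend0_linear.
Definition lend_opp f := LEnd (lend_opp_linear f).
Definition lend_add f g := LEnd (lend_add_linear f g).
Definition lend_scale a f := LEnd (lend_scale_linear a f).
Definition lend1 := LEnd lend1_linear.
Definition lend_mul f g := LEnd (lend_mul_linear f g).

Fact lend_addA : associative lend_add.
Proof. by move=> f g h; apply: lendP => v /=; rewrite addrA. Qed.
Fact lend_addC : commutative lend_add.
Proof. by move=> f g; apply: lendP => v /=; rewrite addrC. Qed.
Fact lend_add0 : left_id lend0 lend_add.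
Proof. by move=> f; apply: lendP => v /=; rewrite add0r. Qed.
Fact lend_addN : left_inverse lend0 lend_opp lend_add.
Proof. by move=> f; apply: lendP => v /=; rewrite addNr. Qed.
HB.instance Definition _ :=
  GRing.isZmodule.Build lend lend_addA lend_addC lend_add0 lend_addN.

Fact lend_mulA : associative lend_mul.
Proof. by move=> f g h; apply: lendP. Qed.
Fact lend_mul1l : left_id lend1 lend_mul.
Proof. by move=> f; apply: lendP. Qed.
Fact lend_mul1r : right_id lend1 lend_mul.
Proof. by move=> f; apply: lendP. Qed.
Fact lend_mulDl : left_distributive lend_mul lend_add.
Proof. by move=> f g h; apply: lendP. Qed.
Fact lend_mulDr : right_distributive lend_mul lend_add.
Proof. by move=> f g h; apply: lendP => v /=; rewrite linearD. Qed.
HB.instance Definition _ := GRing.Zmodule_isPzRing.Build lend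
  lend_mulA lend_mul1l lend_mul1r lend_mulDl lend_mulDr.

Fact lend_scaleA a b f : lend_scale a (lend_scale b f) = lend_scale (a * b) f.
Proof. by apply: lendP => v /=; rewrite scalerA. Qed.
Fact lend_scale1 : left_id 1 lend_scale.
Proof. by move=> f; apply: lendP => v /=; rewrite scale1r. Qed.
Fact lend_scaleDr : right_distributive lend_scale +%R.
Proof. by move=> a f g; apply: lendP => v /=; rewrite scalerDr. Qed.
Fact lend_scaleDl f : {morph lend_scale^~ f : a b / a + b}.
Proof. by move=> a b; apply: lendP => v /=; rewrite scalerDl. Qed.
HB.instance Definition _ := GRing.Zmodule_isLmodule.Build k lend
  lend_scaleA lend_scale1 lend_scaleDr lend_scaleDl.

Fact lend_neq0 : lend1 != 0 :> lend.
Proof.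
apply/eqP => /(congr1 (fun f : lend => f 1)) /= /eqP.
by rewrite oner_eq0.
Qed.
HB.instance Definition _ := GRing.PzSemiRing_isNonZero.Build lend lend_neq0.

Fact lend_scaleAl (a : k) (f g : lend) : a *: (f * g) = a *: f * g.
Proof. exact: lendP. Qed.
HB.instance Definition _ := GRing.Lmodule_isLalgebra.Build k lend lend_scaleAl.

Fact lend_scaleAr (a : k) (f g : lend) : a *: (f * g) = f * (a *: g).
Proof. by apply: lendP => v /=; rewrite linearZ. Qed.
HB.instance Definition _ := GRing.Lalgebra_isAlgebra.Build k lend lend_scaleAr.
End LinearEndomorphisms.


Section Subalgebras.
Variables (k : fieldType) (U : algType k).

(** Closure is stated for a [Prop]-valued subset; classical [asbool] then makes it an [algType], to
    which the universal property can be applied. *)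
Record subalgebra := Subalgebra {
  subalg_carrier :> U -> Prop;
  subalg1 : subalg_carrier 1;
  subalg_lin : forall c u v,
    subalg_carrier u -> subalg_carrier v -> subalg_carrier (c *: u + v);
  subalgM : forall u v,
    subalg_carrier u -> subalg_carrier v -> subalg_carrier (u * v) }.

Variable P : subalgebra.

Definition subalg_pred : pred U := fun u => `[< P u >].

Fact subalg_pred_closed : GRing.subsemialg_closed subalg_pred.
Proof.
have P0 : P 0 by rewrite -(addNr 1) -scaleN1r; apply: subalg_lin; apply: subalg1.
split; first exact/asboolP/subalg1.
- split=> [|u v /asboolP Pu /asboolP Pv]; first exact/asboolP.
  by apply/asboolP; rewrite -[u]scale1r; apply: subalg_lin.
- move=> c u /asboolP Pu; apply/asboolP; rewrite -[_ *: _]addr0.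
  exact: subalg_lin.
- by move=> u v /asboolP Pu /asboolP Pv; apply/asboolP; apply: subalgM.
Qed.
HB.instance Definition _ :=
  GRing.isSubalgClosed.Build k U subalg_pred subalg_pred_closed.

Record subalg_type := SubalgElt {
  subalg_val : U; subalg_valP : subalg_pred subalg_val }.
HB.instance Definition _ := [isSub for subalg_val].
HB.instance Definition _ := [Choice of subalg_type by <:].
HB.instance Definition _ := [SubChoice_isSubAlgebra of subalg_type by <:].
End Subalgebras.

(** * Derivations and induction on an enveloping algebra *)

Section Derivations.
Variables (k : fieldType) (n : nat).
Local Notation S := {mpoly k[n]}.

Lemma derivation1 (D : S -> S) : is_derivation D -> D 1 = 0.
Proof.
move=> [_ DM]; have := DM 1 1; rewrite !mulr1 mul1r => /eqP.
by rewrite -subr_eq0 opprD addNKr oppr_eq0 => /eqP.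
Qed.

Lemma derivation0 (D : S -> S) : is_derivation D -> D 0 = 0.
Proof.
by move=> [DL _]; have := DL (-1) 0 0; rewrite scaler0 addr0 scaleN1r addNr.
Qed.

(** Both sides are linear and satisfy the Leibniz rule, so agreement on the variables spreads to
    monomials and then to all polynomials. *)
Lemma derivationE (D : S -> S) : is_derivation D ->
  forall s, D s = \sum_(l < n) D 'X_l * s^`M(l).
Proof.
move=> dD; have [DL DM] := dD.
pose E (s : S) := \sum_(l < n) D 'X_l * s^`M(l).
have EM (p q : S) : D p = E p -> D q = E q -> D (p * q) = E (p * q).
  rewrite DM => -> ->; rewrite /E mulr_sumr mulr_suml -big_split.
  by apply: eq_bigr => l _ /=; rewrite mderivM mulrDr addrC -mulrA [p * (_ * _)]mulrCA.
have E1 : D 1 = E 1.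
  by rewrite (derivation1 dD) /E big1 // => l _; rewrite mderivC mulr0.
have EX m : D 'X_[m] = E 'X_[m].
  rewrite mpolyXE_id; elim/big_ind: _ => // l _.
  elim: (m l) => [//|d IHd]; rewrite exprS; apply: EM => //.
  rewrite /E (bigD1 l) //= big1 => [|r rl].
    rewrite mderivX mnm1E eqxx scale1r.
    have -> : (U_(l) - U_(l) = 0)%MM by apply/mnmP => r; rewrite mnmBE subnn mnm0E.
    by rewrite mpolyX0 mulr1 addr0.
  by rewrite mderivX mnm1E eq_sym (negPf rl) scale0r mulr0.
elim/mpolyind => [|c m p _ _ IHp].
  by rewrite (derivation0 dD) big1 // => l _; rewrite mderiv0 mulr0.
rewrite DL IHp EX /E scaler_sumr -big_split; apply: eq_bigr => l _ /=.
by rewrite mderivD mderivZ mulrDr scalerAr.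
Qed.

Lemma in_span_derivation (alpha : 'I_n -> S -> S) (D : S -> S) :
  (forall p, is_derivation (alpha p)) -> in_span alpha D -> is_derivation D.
Proof.
move=> da [s ->]; split=> [c p q|p q].
  rewrite scaler_sumr -big_split; apply: eq_bigr => r _ /=.
  by rewrite (da r).1 mulrDr scalerAr.
rewrite mulr_sumr mulr_suml -big_split; apply: eq_bigr => r _ /=.
by rewrite (da r).2 mulrDr mulrCA -mulrA.
Qed.

End Derivations.

Section Generation.
Variables (k : fieldType) (n : nat).
Local Notation S := {mpoly k[n]}.
Variables (alpha : 'I_n -> S -> S) (U : algType k) (i : S -> U)
  (j : (S -> S) -> U).
Hypothesis lr : LR_compatible alpha i j.

Lemma in_span_lin c D E : in_span alpha D -> in_span alpha E ->
  in_span alpha (fun t => c *: D t + E t).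
Proof.
move=> [s ->] [t ->]; exists (fun r => c *: s r + t r); apply/funext => x.
rewrite scaler_sumr -big_split; apply: eq_bigr => r _ /=.
by rewrite mulrDl scalerAl.
Qed.

Lemma in_span_smul s D : in_span alpha D -> in_span alpha (der_smul s D).
Proof.
move=> [t ->]; exists (fun r => s * t r); apply/funext => x.
by rewrite /der_smul mulr_sumr; apply: eq_bigr => r _; rewrite mulrA.
Qed.

Lemma in_span0 : in_span alpha (fun _ => 0).
Proof.
by exists (fun _ => 0); apply/funext => x; rewrite big1 // => r _; rewrite mul0r.
Qed.

Lemma in_span_alpha r : in_span alpha (alpha r).
Proof.
exists (fun q => (q == r)%:R); apply/funext => x.
rewrite (bigD1 r) //= eqxx mul1r big1 ?addr0 // => q /negPf ->.
by rewrite mul0r.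
Qed.

Lemma LR_j0 : j (fun _ => 0) = 0.
Proof.
have [_ jL _ _ _] := lr; have := jL (-1) _ _ in_span0 in_span0.
by rewrite scaler0 addr0 scaleN1r addNr.
Qed.

Lemma LR_j_sum (s : 'I_n -> S) :
  j (fun t => \sum_(r < n) s r * alpha r t) = \sum_(r < n) i (s r) * j (alpha r).
Proof.
have [_ jL _ jZ _] := lr.
(* Linearity of [j] is available only on the span, so membership of each partial sum is carried
   through the induction. *)
suff H (l : seq 'I_n) : in_span alpha (fun t => \sum_(r <- l) s r * alpha r t) /\
  j (fun t => \sum_(r <- l) s r * alpha r t) = \sum_(r <- l) i (s r) * j (alpha r).
  exact: (H _).2.
elim: l => [|r l [IH1 IH2]].
  have -> : (fun t => \sum_(r <- [::]) s r * alpha r t) = (fun _ => 0).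
    by apply/funext => x; rewrite big_nil.
  by rewrite big_nil LR_j0; split=> //; apply: in_span0.
have -> : (fun t => \sum_(r0 <- r :: l) s r0 * alpha r0 t) =
  (fun t => 1 *: der_smul (s r) (alpha r) t + \sum_(r0 <- l) s r0 * alpha r0 t).
  by apply/funext => x; rewrite big_cons scale1r.
have Hr := in_span_smul (s r) (in_span_alpha r).
split; first exact: in_span_lin.
by rewrite jL // IH2 big_cons -jZ ?scale1r //; apply: in_span_alpha.
Qed.

Hypothesis bracket_span : forall D E, in_span alpha D -> in_span alpha E ->
  in_span alpha (der_bracket D E).
Hypothesis env : is_enveloping_algebra alpha i j.

(** The elements satisfying [P] form a subalgebra containing the generators. The universal property
    maps [U] into it; followed by the inclusion, this map must be the identity by uniqueness. *)
Lemma enveloping_ind (P : U -> Prop) :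
  (forall s, P (i s)) -> (forall r, P (j (alpha r))) ->
  (forall u v, P u -> P v -> P (u + v)) ->
  (forall u v, P u -> P v -> P (u * v)) ->
  forall u, P u.
Proof.
move=> Pi Pj PD PM.
have [[iL iM i1] jL jB jZ jC] := lr.
have iZ c : i c%:A = c%:A.
  have i0 : i 0 = 0 by have := iL (-1) 0 0; rewrite scaler0 addr0 scaleN1r addNr.
  by have := iL c 1 0; rewrite !addr0 i0 addr0 i1.
have P1 : P 1 by rewrite -i1.
have PL c u v : P u -> P v -> P (c *: u + v).
  by move=> Pu Pv; apply: PD => //; rewrite -mulr_algl -iZ; apply: PM.
pose Q := Subalgebra P1 PL PM; pose A : algType k := subalg_type Q.
have PS u : P u -> subalg_pred Q u by move=> /asboolP.
pose f s : A := SubalgElt (PS _ (Pi s)).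
have Pspan D : in_span alpha D -> P (j D).
  move=> [s ->]; rewrite LR_j_sum; elim/big_ind: _ => // [|r _].
    have -> : 0 = i 0%:A :> U by rewrite iZ scale0r.
    exact: Pi.
  by apply: (subalgM (s := Q)); [apply: Pi|apply: Pj].
(* The default [0] is taken only when [j D] is outside the subalgebra, which cannot happen for [D]
   in the span. *)
pose g D : A := insubd 0 (j D).
have fE s : \val (f s) = i s by [].
have gE D : in_span alpha D -> \val (g D) = j D.
  by move=> sD; rewrite val_insubd (PS _ (Pspan _ sD)).
have lr' : LR_compatible alpha f g.
  split.
  - split=> [c p q|p q|]; apply: val_inj.
    + by rewrite fE iL linearP.
    + by rewrite fE iM rmorphM.
    + by rewrite fE i1 rmorph1.
  - move=> c D E sD sE; apply: val_inj.
    by rewrite linearP /= !gE //; [apply: jL|apply: in_span_lin].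
  - move=> D E sD sE; apply: val_inj.
    by rewrite rmorphB !rmorphM /= !gE //; [apply: jB|apply: bracket_span].
  - move=> s D sD; apply: val_inj.
    by rewrite rmorphM /= !gE //; [apply: jZ|apply: in_span_smul].
  - move=> s D sD; apply: val_inj.
    by rewrite rmorphB !rmorphM /= !gE //; apply: jC.
have [[h [hL hi hj]] _] := env.2 A f g lr'.
have [_ uniq] := env.2 U i j lr.
move=> u; have -> : u = \val (h u).
  have [hA hM h1] := hL.
  apply: (uniq id (fun u => \val (h u))) => //.
  - split=> [c p q|p q|]; [by rewrite hA linearP|by rewrite hM rmorphM|].
    by rewrite h1 rmorph1.
  - by move=> s; rewrite hi.
  - by move=> D sD; rewrite hj // gE.
by apply/asboolP; exact: (valP (h u)).
Qed.
End Generation.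

(** * Normal ordering *)

(** In a noncommutative ring [mmap1] is the product in increasing order of indices. All factors
    before [r] are trivial, so [h r] merges with the factor at [r]. *)
Lemma mmap1_mulU (R : nzRingType) (n : nat) (h : 'I_n -> R) (r : 'I_n)
    (m : 'X_{1..n}) :
  (forall q : 'I_n, (q < r)%N -> m q = 0%N) -> h r * mmap1 h m = mmap1 h (U_(r) + m).
Proof.
move=> m0; rewrite /mmap1.
have Esort : sorted ltn (map val (index_enum 'I_n)).
  by rewrite [index_enum _]unlock -enumT val_enum_ord iota_ltn_sorted.
case/splitPr: (index_enum 'I_n) / (mem_index_enum r) Esort => s1 s2.
rewrite map_cat /= => Esort.
have := Esort; rewrite sorted_pairwise; last exact: ltn_trans.
rewrite pairwise_cat /= => /and3P[/allrelP lt1 _ /andP[/allP lt2 _]].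
have {}lt1 q : q \in s1 -> (q < r)%N.
  by move=> qs; apply: lt1; [apply: map_f|apply: mem_head].
have {}lt2 q : q \in s2 -> q != r.
  by move=> qs; rewrite -val_eqE gtn_eqF //; apply/lt2/map_f.
rewrite !big_cat !big_cons /=.
have -> : \prod_(q <- s1) h q ^+ m q = 1.
  by rewrite big_seq big1 // => q qs; rewrite m0 ?lt1.
have -> : \prod_(q <- s1) h q ^+ (U_(r) + m)%MM q = 1.
  rewrite big_seq big1 // => q qs; have qr := lt1 _ qs.
  by rewrite mnmDE m0 // mnm1E -val_eqE gtn_eqF.
rewrite !mul1r mulrA -exprS mnmDE mnm1E eqxx add1n; congr (_ * _).
rewrite !(big_seq _ _ s2); apply: eq_bigr => q /lt2 qr.
by rewrite mnmDE mnm1E eq_sym (negPf qr).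
Qed.

Section NormalForm.
Variables (k : fieldType) (n : nat).
Local Notation S := {mpoly k[n]}.
Variables (alpha : 'I_n -> S -> S) (U : algType k) (i : {rmorphism S -> U})
  (j : (S -> S) -> U).
Hypothesis lr : LR_compatible alpha i j.
Hypothesis bracket_span : forall D E, in_span alpha D -> in_span alpha E ->
  in_span alpha (der_bracket D E).

Local Notation jr := (fun r => j (alpha r)).
(** The variables of [{mpoly S[n]}] are placeholders for the [alpha r]: coefficients stand on the
    left and the generators follow in increasing order. The map is additive, not multiplicative. *)
Definition normal_form : {mpoly S[n]} -> U := mmap i (fun r => j (alpha r)).
(** The order filtration; since [msize] is the degree plus one, the bound says degree at most
    [d]. *)
Definition filt (d : nat) (u : U) : Prop :=
  exists2 Q, (msize Q <= d.+1)%N & u = normal_form Q.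

Lemma filtW d e u : (d <= e)%N -> filt d u -> filt e u.
Proof. by move=> de [Q Qd ->]; exists Q => //; apply: (leq_trans Qd). Qed.

Lemma filt0 d : filt d 0.
Proof. by exists 0; rewrite ?msize0 // /normal_form mmap0. Qed.

Lemma filtD d u v : filt d u -> filt d v -> filt d (u + v).
Proof.
move=> [Q Qd ->] [R Rd ->]; exists (Q + R); last by rewrite /normal_form mmapD.
by apply: (leq_trans (msizeD_le _ _)); rewrite geq_max Qd.
Qed.

Lemma filt_sum d (I : Type) (l : seq I) (F : I -> U) :
  (forall x, filt d (F x)) -> filt d (\sum_(x <- l) F x).
Proof. by move=> dF; elim/big_ind: _ => // [|u v]; [apply: filt0|apply: filtD]. Qed.

Lemma filtZ d s u : filt d u -> filt d (i s * u).
Proof.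
move=> [Q Qd ->]; exists (s *: Q); last by rewrite /normal_form mmapZ.
by apply: (leq_trans (msizeZ_le _ _)).
Qed.

Lemma filt_mmap1 (m : 'X_{1..n}) : filt (mdeg m) (mmap1 jr m).
Proof. by exists 'X_[m]; rewrite ?msizeX // /normal_form mmapX. Qed.

(** Moving [j (alpha r)] to the right past a coefficient [s] costs only the term [i (alpha r s)],
    which does not raise the order. Ordered monomials are therefore enough. *)
Lemma filt_mulj_mmap1 d r u :
  (forall m : 'X_{1..n}, (mdeg m <= d)%N -> filt d.+1 (j (alpha r) * mmap1 jr m)) ->
  filt d u -> filt d.+1 (j (alpha r) * u).
Proof.
move=> H [Q Qd ->]; rewrite /normal_form /mmap big_seq mulr_sumr.
elim/big_ind: _ => [|u1 v|m mQ]; [exact: filt0|exact: filtD|].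
have md : (mdeg m <= d)%N by rewrite -ltnS (leq_trans (msize_mdeg_lt mQ)).
have [_ _ _ _ /(_ Q@_m _ (in_span_alpha alpha r)) jC] := lr.
rewrite mulrA -[j (alpha r) * _](subrK (i Q@_m * j (alpha r))) jC mulrDl -mulrA.
apply: filtD; last by apply/filtZ/H.
by apply/filtZ/(filtW _ (filt_mmap1 m)); rewrite ltnW.
Qed.

(* With [q0 < r] the smallest index occurring in [m], so that
   [alpha^m = alpha_q0 alpha^m'], rewrite [alpha_r alpha^m] as
   [[alpha_r, alpha_q0] alpha^m' + alpha_q0 (alpha_r alpha^m')]: both [alpha_r alpha^m']
   and the bracket term are covered by the induction on [d], and the remaining left
   multiplication by [alpha_q0] by the inner induction on the index. *)
Lemma filt_mulj d r u : filt d u -> filt d.+1 (j (alpha r) * u).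
Proof.
elim: d r u => [|d IHd] r u; last first.
  have [p] := ubnP (r : nat); elim: p r u => // p IHp r u; rewrite ltnS => rp.
  apply: filt_mulj_mmap1 => m md.
  have [/existsP[q /andP[qr mq]]|] :=
    boolP [exists q : 'I_n, (q < r)%N && (m q != 0%N)]; last first.
    rewrite negb_exists => /forallP m0.
    rewrite mmap1_mulU => [|q qr]; last by have := m0 q; rewrite qr negbK => /eqP.
    by apply: (filtW _ (filt_mmap1 _)); rewrite mdegD mdeg1.
  have [q0 /andP[q0r mq0] q0min] := @arg_minnP _ q
    (fun q : 'I_n => (q < r)%N && (m q != 0%N)) val (introT andP (conj qr mq)).
  pose m' := (m - U_(q0))%MM.
  have mE : m = (U_(q0) + m')%MM.
    by rewrite addmC submK // lep1mP.
  have m'd : (mdeg m' <= d)%N by move: md; rewrite mE mdegD mdeg1 add1n ltnS.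
  rewrite mE -mmap1_mulU; last first.
    move=> q1 q1q0; apply/eqP/negPn/negP => m'q1.
    have q01 : (q0 <= q1)%N.
      apply: q0min; rewrite (ltn_trans q1q0 q0r) /= mE mnmDE.
      by rewrite addn_eq0 (negPf m'q1) andbF.
    by rewrite leqNgt q1q0 in q01.
  have [_ _ /(_ _ _ (in_span_alpha alpha r) (in_span_alpha alpha q0)) jB _ _] := lr.
  have Fm' := filtW m'd (filt_mmap1 m').
  rewrite mulrA -[j (alpha r) * _](subrK (j (alpha q0) * j (alpha r))) -jB.
  rewrite mulrDl -mulrA; apply: filtD; last first.
    by apply: (IHp q0); [apply: (leq_trans q0r)|apply: IHd].
  have [c ->] := bracket_span (in_span_alpha alpha r) (in_span_alpha alpha q0).
  rewrite (LR_j_sum lr) mulr_suml; apply: filt_sum => x.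
  by rewrite -mulrA; apply/filtZ/(filtW (leqnSn _))/IHd.
apply: filt_mulj_mmap1 => m; rewrite leqn0 mdeg_eq0 => /eqP ->.
rewrite mmap11 mulr1 -[j _](mmap1U (fun r => j (alpha r)) r).
by apply: (filtW _ (filt_mmap1 _)); rewrite mdeg1.
Qed.

Hypothesis env : is_enveloping_algebra alpha i j.

Lemma normal_form_surj u : exists Q, u = normal_form Q.
Proof.
(* Left multiplication by [u] is tracked on every filtration step, because this property passes to
   products by composition; the claim is the case of [1]. *)
suff H : forall d v, filt d v -> exists e, filt e (u * v).
  have [|e [Q _ E]] := H 0%N 1; last by exists Q; rewrite -E mulr1.
  by rewrite -(mmap11 jr); apply: filtW (filt_mmap1 _); rewrite mdeg0.
elim/(enveloping_ind lr bracket_span env): u => [s|r|u v Hu Hv|u v Hu Hv] d w dw.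
- by exists d; apply: filtZ.
- by exists d.+1; apply: filt_mulj.
- have [e1 F1] := Hu _ _ dw; have [e2 F2] := Hv _ _ dw.
  exists (maxn e1 e2); rewrite mulrDl; apply: filtD.
    by apply: filtW F1; rewrite leq_maxl.
  by apply: filtW F2; rewrite leq_maxr.
by have [e1 F1] := Hv _ _ dw; have [e2 F2] := Hu _ _ F1; exists e2; rewrite -mulrA.
Qed.
End NormalForm.

(** * The action on symbols *)

Lemma msize_leP (R : nzRingType) (n d : nat) (Q : {mpoly R[n]}) :
  reflect (forall m, (d <= mdeg m)%N -> Q@_m = 0) (msize Q <= d)%N.
Proof.
apply: (iffP idP) => [Qd m dm|Q0].
  by apply/memN_msupp_eq0/msize_mdeg_ge/(leq_trans Qd).
rewrite msizeE; apply/bigmax_leqP_seq => m mQ _.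
by rewrite ltnNge; apply: contraL mQ => /Q0; rewrite mcoeff_msupp negbK => ->.
Qed.

(** In degrees: at most [a] and less than [b] give less than [a + b], zero factors included. *)
Lemma msizeM_leq (R : idomainType) (n a b : nat) (p q : {mpoly R[n]}) :
  (msize p <= a.+1)%N -> (msize q <= b)%N -> (msize (p * q) <= a + b)%N.
Proof.
move=> pa qb; have [->|p0] := eqVneq p 0; first by rewrite mul0r msize0.
have [->|q0] := eqVneq q 0; first by rewrite mulr0 msize0.
by rewrite msizeM // -subn1 leq_subLR add1n -addSn leq_add.
Qed.

(** This is d/dx_l with the xi held constant, whereas [mderiv] on [{mpoly S[n]}] is d/dxi_l. *)
HB.lock Definition coef_deriv (k : fieldType) (n : nat) (l : 'I_n)
  (v : {mpoly {mpoly k[n]}[n]}) : {mpoly {mpoly k[n]}[n]} :=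
  map_mpoly (mderiv l) v.

Section CoefficientDerivative.
Variables (k : fieldType) (n : nat).
Local Notation S := {mpoly k[n]}.
Implicit Types (s : S) (v : {mpoly S[n]}) (l r : 'I_n).

Lemma mcoeff_coef_deriv l v m : (coef_deriv l v)@_m = (v@_m)^`M(l).
Proof. by rewrite unlock; apply: mcoeff_map_mpoly. Qed.

Lemma coef_deriv_additive l : additive (@coef_deriv k n l).
Proof. by rewrite unlock; apply: map_mpoly_is_additive. Qed.
HB.instance Definition _ l := GRing.isAdditive.Build {mpoly S[n]} {mpoly S[n]}
  (@coef_deriv k n l) (coef_deriv_additive l).

Lemma coef_derivZ l s v :
  coef_deriv l (s *: v) = s^`M(l) *: v + s *: coef_deriv l v.
Proof.
apply/mpolyP => m; rewrite mcoeff_coef_deriv mcoeffD !mcoeffZ.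
by rewrite mcoeff_coef_deriv mderivM.
Qed.

Lemma coef_deriv_mpolyX l m : coef_deriv l ('X_[m] : {mpoly S[n]}) = 0.
Proof.
apply/mpolyP => m'; rewrite mcoeff_coef_deriv mcoeffX mcoeff0.
by rewrite -[_%:R](mpolyC_nat n k); apply: mderivC.
Qed.

Lemma coef_derivXM l r v : coef_deriv l ('X_r * v) = 'X_r * coef_deriv l v.
Proof.
rewrite [v]mpolyE mulr_sumr !raddf_sum mulr_sumr; apply: eq_bigr => m _ /=.
rewrite -scalerAr -mpolyXD !coef_derivZ !coef_deriv_mpolyX !scaler0 !addr0.
by rewrite -scalerAr -mpolyXD.
Qed.

Lemma coef_deriv_comm l r v :
  coef_deriv l (coef_deriv r v) = coef_deriv r (coef_deriv l v).
Proof. by apply/mpolyP => m; rewrite !mcoeff_coef_deriv mderiv_comm. Qed.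

Lemma mderiv_coef_deriv l r v :
  (coef_deriv l v)^`M(r) = coef_deriv l (v^`M(r)).
Proof.
apply/mpolyP => m.
by rewrite mcoeff_mderiv 2!mcoeff_coef_deriv mcoeff_mderiv mderivMn.
Qed.

Lemma msize_coef_deriv l v : (msize (coef_deriv l v) <= msize v)%N.
Proof.
apply/msize_leP => m vm; rewrite mcoeff_coef_deriv.
by rewrite (msize_leP _ _ (leqnn _) m vm) mderiv0.
Qed.

(** The conjugate of d/dx_l by exp(sum_l xi_l x_l). *)
Definition shifted_deriv l v : {mpoly S[n]} := coef_deriv l v + 'X_l * v.

Lemma shifted_deriv_additive l : additive (shifted_deriv l).
Proof.
by move=> u v; rewrite /shifted_deriv raddfB mulrBr opprD addrACA.
Qed.
HB.instance Definition _ l := GRing.isAdditive.Build {mpoly S[n]} {mpoly S[n]}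
  (shifted_deriv l) (shifted_deriv_additive l).

Lemma shifted_derivZ l s v :
  shifted_deriv l (s *: v) = s^`M(l) *: v + s *: shifted_deriv l v.
Proof. by rewrite /shifted_deriv coef_derivZ -scalerAr scalerDr addrA. Qed.

Lemma shifted_deriv_comm l r v :
  shifted_deriv l (shifted_deriv r v) = shifted_deriv r (shifted_deriv l v).
Proof.
rewrite /shifted_deriv !raddfD /= !coef_derivXM coef_deriv_comm !mulrDr.
by rewrite addrACA ['X_l * ('X_r * v)]mulrCA.
Qed.

(** The Heisenberg relation between d/dxi_r and d/dx_l + xi_l; it is what makes d/dxi_l detect
    commutators with x_l. *)
Lemma mderiv_shifted_deriv l r v :
  (shifted_deriv l v)^`M(r) = shifted_deriv l (v^`M(r)) + (l == r)%:R *: v.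
Proof.
rewrite /shifted_deriv mderivD mderiv_coef_deriv mderivM mderivX mnm1E.
have [->|_] := eqVneq l r; last by rewrite !scale0r mul0r add0r addr0.
have -> : (U_(r) - U_(r) = 0)%MM by apply/mnmP => q; rewrite mnmBE subnn mnm0E.
by rewrite mpolyX0 !scale1r mul1r -addrA [v + _]addrC.
Qed.
End CoefficientDerivative.

Section SymbolModule.
Variables (k : fieldType) (n : nat).
Local Notation S := {mpoly k[n]}.

(* A copy of [{mpoly S[n]}] carrying the structure of a module over [k], not [S]. *)
Definition symbols : Type := {mpoly S[n]}.
HB.instance Definition _ := GRing.NzRing.copy symbols {mpoly S[n]}.

Definition symbols_scale (c : k) (v : symbols) : symbols :=
  c%:MP *: (v : {mpoly S[n]}).
Fact symbols_scaleA a b v :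
  symbols_scale a (symbols_scale b v) = symbols_scale (a * b) v.
Proof. by rewrite /symbols_scale scalerA -mpolyCM. Qed.
Fact symbols_scale1 : left_id 1 symbols_scale.
Proof. by move=> v; rewrite /symbols_scale mpolyC1 scale1r. Qed.
Fact symbols_scaleDr : right_distributive symbols_scale +%R.
Proof. by move=> a u v; apply: (scalerDr _ (u : {mpoly S[n]})). Qed.
Fact symbols_scaleDl v : {morph symbols_scale^~ v : a b / a + b}.
Proof. by move=> a b; rewrite /symbols_scale mpolyCD scalerDl. Qed.
HB.instance Definition _ := GRing.Zmodule_isLmodule.Build k symbols
  symbols_scaleA symbols_scale1 symbols_scaleDr symbols_scaleDl.
Fact symbols_scaleAl (a : k) (u v : symbols) : a *: (u * v) = a *: u * v.
Proof. exact: (scalerAl _ (u : {mpoly S[n]})). Qed.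
HB.instance Definition _ :=
  GRing.Lmodule_isLalgebra.Build k symbols symbols_scaleAl.

Lemma symbols_scaleE (c : k) (v : symbols) :
  c *: v = c%:MP *: (v : {mpoly S[n]}).
Proof. by []. Qed.

Fact scale_op_linear (s : S) :
  linear (fun v : symbols => s *: (v : {mpoly S[n]}) : symbols).
Proof.
move=> c u v; rewrite symbols_scaleE [LHS]scalerDr scalerA mulrC -scalerA.
by [].
Qed.
Definition scale_op s := LEnd (scale_op_linear s).

Definition field_op_fun (D : S -> S) (v : {mpoly S[n]}) : {mpoly S[n]} :=
  \sum_(l < n) D 'X_l *: shifted_deriv l v.

Fact field_op_linear (D : S -> S) : linear (field_op_fun D : symbols -> symbols).
Proof.
move=> c u v; pose u' : {mpoly S[n]} := u; pose v' : {mpoly S[n]} := v.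
change (field_op_fun D (c%:MP *: u' + v') =
  c%:MP *: field_op_fun D u' + field_op_fun D v').
rewrite /field_op_fun scaler_sumr -big_split; apply: eq_bigr => l _ /=.
rewrite [shifted_deriv _ _]raddfD /= shifted_derivZ mderivC scale0r add0r.
by rewrite scalerDr scalerA mulrC -scalerA.
Qed.
Definition field_op D := LEnd (field_op_linear D).

Variable alpha : 'I_n -> S -> S.
Hypothesis alpha_der : forall r, is_derivation (alpha r).

(** Separates a first-order part, where [D] differentiates the coefficients of [E], from a
    second-order part that will cancel in the commutator. *)
Lemma field_op_mulE (D E : S -> S) (v : {mpoly S[n]}) : is_derivation D ->
  field_op_fun D (field_op_fun E v) =
  \sum_(r < n) D (E 'X_r) *: shifted_deriv r v +
  \sum_(l < n) \sum_(r < n) (D 'X_l * E 'X_r) *: shifted_deriv l (shifted_deriv r v).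
Proof.
move=> dD; rewrite {1}/field_op_fun.
under [X in _ = X + _]eq_bigr => r _ do rewrite (derivationE dD) scaler_suml.
rewrite exchange_big -big_split; apply: eq_bigr => l _ /=.
rewrite /field_op_fun raddf_sum scaler_sumr -big_split; apply: eq_bigr => r _ /=.
by rewrite shifted_derivZ scalerDr !scalerA.
Qed.

Lemma symbols_LR_compatible : LR_compatible alpha scale_op field_op.
Proof.
split.
- split=> [c p q|p q|]; apply: lendP => v /=.
  + change ((c *: p + q) *: (v : {mpoly S[n]}) =
      c%:MP *: (p *: (v : {mpoly S[n]})) + q *: (v : {mpoly S[n]})).
    by rewrite scalerDl scalerA mul_mpolyC.
  + by rewrite scalerA.
  + exact: scale1r.
- move=> c D E _ _; apply: lendP => v.
  change (field_op_fun (fun t => c *: D t + E t) v =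
    c%:MP *: field_op_fun D v + field_op_fun E v).
  rewrite /field_op_fun scaler_sumr -big_split; apply: eq_bigr => l _ /=.
  by rewrite scalerDl scalerA mul_mpolyC.
- move=> D E sD sE; apply: lendP => v.
  have [dD dE] := (in_span_derivation alpha_der sD, in_span_derivation alpha_der sE).
  change (field_op_fun (der_bracket D E) v =
    field_op_fun D (field_op_fun E v) - field_op_fun E (field_op_fun D v)).
  rewrite !field_op_mulE // opprD addrACA.
  (* After exchanging [l] and [r] the second-order parts coincide, since the shifted derivatives
     commute. *)
  rewrite [X in _ = _ + (_ - X)]exchange_big /=.
  rewrite [X in _ = _ + X](_ : _ = 0) ?addr0; last first.
    apply/eqP; rewrite subr_eq0; apply/eqP; apply: eq_bigr => l _.
    by apply: eq_bigr => r _; rewrite mulrC shifted_deriv_comm.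
  rewrite -sumrB; apply: eq_bigr => r _.
  by rewrite /der_bracket scalerBl.
- move=> s D sD; apply: lendP => v.
  change (s *: field_op_fun D v = field_op_fun (der_smul s D) v).
  by rewrite /field_op_fun scaler_sumr; apply: eq_bigr => l _; rewrite scalerA.
move=> s D sD; have dD := in_span_derivation alpha_der sD; apply: lendP => v.
change (field_op_fun D (s *: (v : {mpoly S[n]})) - s *: field_op_fun D v =
  D s *: (v : {mpoly S[n]})).
rewrite /field_op_fun scaler_sumr -sumrB (derivationE dD) scaler_suml.
apply: eq_bigr => l _; rewrite shifted_derivZ scalerDr !scalerA [s * _]mulrC.
by rewrite addrK.
Qed.
End SymbolModule.

(** * Symbols of normally ordered elements *)

Lemma kalg_mor_rmorphism (k : fieldType) (A B : algType k) (f : A -> B) :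
  is_kalg_mor f -> exists g : {rmorphism A -> B}, f = g.
Proof.
move=> [fL fM f1].
have fB : additive f.
  by move=> u v; rewrite -scaleN1r addrC fL scaleN1r addrC.
pose mB := GRing.isZmodMorphism.Build A B f fB.
pose mM := GRing.isMonoidMorphism.Build A B f (f1, fM).
pose g : {rmorphism A -> B} := HB.pack f mB mM.
by exists g.
Qed.

(** If [l] occurs in [m], the coefficient of the [l]-th derivative at [m - U_(l)] is [m l] times
    that of [p] at [m]. Used both over [S], for the xi, and over [k], for the x. *)
Lemma mderiv_eq0_mpolyC (R : nzRingType) (n : nat) (p : {mpoly R[n]}) :
  (forall (x : R) d, x *+ d.+1 = 0 -> x = 0) ->
  (forall l, p^`M(l) = 0) -> p = (p@_0)%:MP.
Proof.
move=> R0 p0; apply: msize1_polyC; apply/msize_leP => m.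
rewrite lt0n mdeg_eq0 => m0.
have [l ml] : exists l, m l != 0%N.
  apply/existsP; apply: contraNT m0; rewrite negb_exists => /forallP m0.
  by apply/eqP/mnmP => l; rewrite mnm0E; have := m0 l; rewrite negbK => /eqP.
apply: (R0 _ (m l).-1); rewrite prednK ?lt0n //.
have := congr1 (mcoeff (m - U_(l))) (p0 l).
rewrite mcoeff_mderiv mcoeff0 submK ?lep1mP // mnmBE mnm1E eqxx subn1.
by rewrite prednK ?lt0n.
Qed.

(** * Substitution of linear forms with nonzero determinant *)

Section SubstituteLinearForms.
Variables (R : idomainType) (n : nat).
Implicit Types (L : 'I_n -> {mpoly R[n]}) (Q : {mpoly R[n]}).

Lemma msize_mmap1_linear L m : (forall r, msize (L r) <= 2)%N ->
  (msize (mmap1 L m) <= (mdeg m).+1)%N.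
Proof.
move=> L2; rewrite mdegE /mmap1.
elim/big_ind2: _ => [|p a q b pa qb|r _]; first by rewrite msize1.
  by rewrite -addnS msizeM_leq.
elim: (m r) => [|d IHd]; first by rewrite expr0 msize1.
by rewrite exprS; apply: (@msizeM_leq _ _ 1 d.+1).
Qed.

Lemma msize_mmap_linear L Q : (forall r, msize (L r) <= 2)%N ->
  (msize (mmap (@mpolyC n R) L Q) <= msize Q)%N.
Proof.
move=> L2; rewrite /mmap big_seq.
elim/big_ind: _ => [|p q pQ qQ|m mQ]; first by rewrite msize0.
  by rewrite (leq_trans (msizeD_le _ _)) // geq_max pQ.
rewrite mul_mpolyC (leq_trans (msizeZ_le _ _)) //.
exact: leq_trans (msize_mmap1_linear _ L2) (msize_mdeg_lt mQ).
Qed.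

Lemma msize_linear_form (a : 'I_n -> R) :
  (msize (\sum_(l < n) a l *: 'X_l : {mpoly R[n]}) <= 2)%N.
Proof.
elim/big_ind: _ => [|p q p2 q2|l _]; first by rewrite msize0.
  by rewrite (leq_trans (msizeD_le _ _)) // geq_max p2.
by rewrite (leq_trans (msizeZ_le _ _)) // msizeX mdeg1.
Qed.

Variable M : 'M[R]_n.
Hypothesis detM : \det M != 0.
Local Notation form := (fun r => \sum_(l < n) M r l *: 'X_l : {mpoly R[n]}).

(* Substituting the forms of the adjugate matrix afterwards amounts to scaling
   every variable by [\det M], which cannot lower the degree. *)
Lemma msize_substitute_forms Q :
  (msize Q <= msize (mmap (@mpolyC n R) form Q))%N.
Proof.
pose L r : {mpoly R[n]} := \sum_(l < n) (\adj M) r l *: 'X_l.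
have L2 r : (msize (L r) <= 2)%N by apply: msize_linear_form.
apply: leq_trans (msize_mmap_linear _ L2); set Q' := mmap _ form Q.
have -> : mmap (@mpolyC n R) L Q' =
  \sum_(m <- msupp Q) (Q@_m * \det M ^+ mdeg m) *: 'X_[m].
  rewrite (_ : Q' = \sum_(m <- msupp Q) (Q@_m)%:MP * mmap1 form m) // rmorph_sum.
  apply: eq_bigr => m _ /=.
  rewrite rmorphM /= [mmap _ _ (Q@_m)%:MP]mmapC -scalerA mul_mpolyC; congr (_ *: _).
  rewrite /mmap1 rmorph_prod mpolyXE_id mdegE -prodrXr -scaler_prod.
  apply: eq_bigr => r _; rewrite rmorphXn -exprZn /=; congr (_ ^+ _).
  rewrite rmorph_sum /=.
  under eq_bigr => l _ do rewrite mmapZ mmapX mmap1U mul_mpolyC scaler_sumr.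
  rewrite exchange_big (bigD1 r) //= [X in _ + X]big1 ?addr0 => [|q qr].
    under eq_bigr => l _ do rewrite scalerA.
    have /matrixP/(_ r r) := mul_mx_adj M; rewrite !mxE eqxx mulr1n => <-.
    by rewrite scaler_suml.
  under eq_bigr => l _ do rewrite scalerA.
  have /matrixP/(_ r q) := mul_mx_adj M; rewrite !mxE eq_sym (negPf qr) mulr0n.
  by rewrite -scaler_suml => ->; rewrite scale0r.
apply/msize_leP => m /(elimT (msize_leP _ _) (leqnn _)).
have [/memN_msupp_eq0 ->//|mQ] := boolP (m \notin msupp Q); rewrite negbK in mQ.
rewrite raddf_sum (bigD1_seq m) ?msupp_uniq //= big1 => [|m' m'm].
  rewrite mcoeffZ mcoeffX eqxx mulr1 addr0 => /eqP.
  by rewrite mulf_eq0 expf_eq0 (negPf detM) andbF orbF => /eqP.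
by rewrite mcoeffZ mcoeffX (negPf m'm) mulr0.
Qed.
End SubstituteLinearForms.

(** * Symbols and commutators in the action of the enveloping algebra *)

Section SymbolEstimate.
Variables (k : fieldType) (n : nat).
Local Notation S := {mpoly k[n]}.
Variables (alpha : 'I_n -> S -> S) (U : algType k) (i : {rmorphism S -> U})
  (j : (S -> S) -> U) (h : {rmorphism U -> lend (symbols k n)}).
Hypothesis hi : forall s, h (i s) = scale_op s.
Hypothesis hj : forall r, h (j (alpha r)) = field_op (alpha r).

Definition act (u : U) (v : {mpoly S[n]}) : {mpoly S[n]} :=
  h u (v : symbols k n).

Lemma actDl u1 u2 v : act (u1 + u2) v = act u1 v + act u2 v.
Proof. by rewrite /act rmorphD. Qed.

Lemma actM u1 u2 v : act (u1 * u2) v = act u1 (act u2 v).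
Proof. by rewrite /act rmorphM. Qed.

Lemma act1 v : act 1 v = v.
Proof. by rewrite /act rmorph1. Qed.

Lemma act0 v : act 0 v = 0.
Proof. by rewrite /act rmorph0. Qed.

Lemma actDr u v w : act u (v + w) = act u v + act u w.
Proof. exact: (raddfD (h u : {linear _ -> _})). Qed.

Lemma act_i s v : act (i s) v = s *: v.
Proof. by rewrite /act hi. Qed.

Lemma act_j r v : act (j (alpha r)) v = field_op_fun (alpha r) v.
Proof. by rewrite /act hj. Qed.

Definition principal_form (r : 'I_n) : {mpoly S[n]} :=
  \sum_(l < n) alpha r 'X_l *: 'X_l.

(** On polynomials of degree at most [e] in xi, [u] acts as multiplication by [w] up to terms of
    degree strictly below [d + e]. *)
Definition has_symbol (d : nat) (u : U) (w : {mpoly S[n]}) :=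
  (msize w <= d.+1)%N /\
  forall v e, (msize v <= e.+1)%N -> (msize (act u v - w * v)%R <= d + e)%N.

Lemma has_symbol1 : has_symbol 0 1 1.
Proof. by split=> [|v e _]; rewrite ?msize1 // act1 mul1r subrr msize0. Qed.

Lemma has_symbolM d1 u1 w1 d2 u2 w2 : has_symbol d1 u1 w1 ->
  has_symbol d2 u2 w2 -> has_symbol (d1 + d2) (u1 * u2) (w1 * w2).
Proof.
move=> [w1d s1] [w2d s2]; split; first by rewrite -addnS msizeM_leq.
move=> v e ve; have dv := s2 _ _ ve.
have u2v : (msize (act u2 v) <= (d2 + e).+1)%N.
  rewrite -[act u2 v](subrK (w2 * v)) (leq_trans (msizeD_le _ _)) // geq_max.
  by rewrite (leq_trans dv) //= -addnS msizeM_leq.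
(* Split u1 u2 v - w1 w2 v as (u1 - w1)(u2 v) + w1 (u2 v - w2 v); each summand has degree below d1 +
   d2 + e. *)
rewrite actM -[X in X - _](subrK (w1 * act u2 v)) -addrA -mulrA -mulrBr.
rewrite (leq_trans (msizeD_le _ _)) // geq_max -addnA s1 //=.
by rewrite msizeM_leq.
Qed.

(** The error consists of the terms [alpha r 'X_l *: coef_deriv l v], which do not raise the degree
    in xi. *)
Lemma has_symbol_j r : has_symbol 1 (j (alpha r)) (principal_form r).
Proof.
split=> [|v e ve]; first exact: msize_linear_form.
rewrite act_j /principal_form /field_op_fun mulr_suml -sumrB.
elim/big_ind: _ => [|p q pe qe|l _]; first by rewrite msize0.
  by rewrite (leq_trans (msizeD_le _ _)) // geq_max pe.
rewrite -scalerAl -scalerBr /shifted_deriv addrK.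
by rewrite (leq_trans (msizeZ_le _ _)) // (leq_trans (msize_coef_deriv _ _)).
Qed.

Lemma has_symbol_mmap1 m :
  has_symbol (mdeg m) (mmap1 (fun r => j (alpha r)) m) (mmap1 principal_form m).
Proof.
rewrite mdegE /mmap1; elim/big_rec3: _ => [|r d u w _ s]; first exact: has_symbol1.
apply: has_symbolM s; elim: (m r) => [|e IHe].
  by rewrite !expr0; apply: has_symbol1.
by rewrite !exprS -add1n; apply: has_symbolM IHe; apply: has_symbol_j.
Qed.

(** The symbol estimate for each ordered monomial is applied to [1], that is with [e = 0]; left
    coefficients do not affect degrees in xi. *)
Lemma msize_symbol_normal_form d Q : (msize Q <= d.+1)%N ->
  (msize (act (normal_form alpha i j Q) 1 - mmap (@mpolyC n S) principal_form Q)%R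
    <= d)%N.
Proof.
move=> Qd; rewrite /normal_form /mmap.
rewrite (big_morph (fun u => act u 1) (fun u1 u2 => actDl u1 u2 1) (act0 1)) -sumrB.
rewrite big_seq; elim/big_ind: _ => [|p q pe qe|m mQ]; first by rewrite msize0.
  by rewrite (leq_trans (msizeD_le _ _)) // geq_max pe.
have md : (mdeg m <= d)%N by rewrite -ltnS (leq_trans (msize_mdeg_lt mQ)).
rewrite actM act_i mul_mpolyC -scalerBr (leq_trans (msizeZ_le _ _)) //.
have [_ /(_ 1 0%N)] := has_symbol_mmap1 m.
by rewrite msize1 mulr1 addn0 => /(_ isT) /leq_trans; apply.
Qed.

Hypothesis ind : forall P : U -> Prop,
  (forall s, P (i s)) -> (forall r, P (j (alpha r))) ->
  (forall u v, P u -> P v -> P (u + v)) ->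
  (forall u v, P u -> P v -> P (u * v)) -> forall u, P u.
Hypothesis lr : LR_compatible alpha i j.

(** By induction on [u]: elements of [S] commute with x_l, the generators reduce to the Heisenberg
    relation, and products follow from the Leibniz rule for the commutator with x_l. *)
Lemma mderiv_act u l v :
  (act u v)^`M(l) = act u (v^`M(l)) + act (u * i 'X_l - i 'X_l * u) v.
Proof.
have [_ _ _ _ jC] := lr.
elim/ind: u v => [s|r|u1 u2 H1 H2|u1 u2 H1 H2] v.
- by rewrite !act_i mderivZ -!rmorphM [s * _]mulrC subrr act0 addr0.
- rewrite jC; last exact: in_span_alpha.
  rewrite act_i !act_j /field_op_fun raddf_sum /=.
  rewrite [X in _ + X](_ : _ = \sum_(q < n) alpha r 'X_q *: ((q == l)%:R *: v)).
    rewrite -big_split; apply: eq_bigr => q _ /=.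
    by rewrite mderivZ mderiv_shifted_deriv scalerDr.
  rewrite (bigD1 l) //= eqxx scale1r big1 ?addr0 // => q /negPf ->.
  by rewrite scale0r scaler0.
- rewrite [act (u1 + u2) v]actDl mderivD H1 H2 addrACA -!actDl.
  by congr (_ + act _ v); rewrite mulrDl mulrDr opprD addrACA.
have -> : u1 * u2 * i 'X_l - i 'X_l * (u1 * u2) =
  u1 * (u2 * i 'X_l - i 'X_l * u2) + (u1 * i 'X_l - i 'X_l * u1) * u2.
  by rewrite mulrBr mulrBl !mulrA addrA subrK.
by rewrite actDl !actM H1 H2 actDr -addrA.
Qed.

Hypothesis pcharS : forall (x : S) d, x *+ d.+1 = 0 -> x = 0.
Hypothesis det_alpha : \det (\matrix_(r, l) alpha r 'X_l) != 0.

Lemma commuting_in_base Q :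
  (forall l, normal_form alpha i j Q * i 'X_l = i 'X_l * normal_form alpha i j Q) ->
  normal_form alpha i j Q = i Q@_0.
Proof.
set u := normal_form _ _ _ Q => uC.
have u1C : act u 1 = ((act u 1)@_0)%:MP.
  apply: mderiv_eq0_mpolyC => // l.
  rewrite mderiv_act uC subrr act0 addr0 mderivC.
  by apply: (addIr (act u 0)); rewrite -actDr !add0r.
have Q1 : (msize Q <= 1)%N.
  case E : (msize Q) => [|[|d]] //.
  (* Here [Q] has degree [d + 1], hence so, at least, has the substituted polynomial [w]. But [w]
     differs from the constant [act u 1] only in degree at most [d], a contradiction. *)
  have := msize_symbol_normal_form (eq_leq E).
  have := msize_substitute_forms det_alpha Q.
  have -> : (fun r => \sum_(l < n) (\matrix_(r, l) alpha r 'X_l) r l *: 'X_l) =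
    principal_form.
    by apply/funext => r; apply: eq_bigr => l _; rewrite mxE.
  set w := mmap _ _ _; rewrite E => dw wd.
  suff wd1 : (msize w <= d.+1)%N by rewrite ltnNge wd1 in dw.
  rewrite -[w](subrK (act u 1)) (leq_trans (msizeD_le _ _)) // geq_max.
  by rewrite -msizeN opprB wd u1C msizeC; case: (_ != 0).
by rewrite /u (msize1_polyC Q1) /normal_form mmapC mcoeffC eqxx mulr1.
Qed.
End SymbolEstimate.

(** * Characteristic zero and the matrix of a triangular basis *)

Lemma pchar0_mulrn_eq0 (k : fieldType) (x : k) d :
  [pchar k] =i pred0 -> x *+ d.+1 = 0 -> x = 0.
Proof.
by move=> /pcharf0P k0 /eqP; rewrite -mulr_natr mulf_eq0 k0 orbF => /eqP.
Qed.

Lemma mpoly_mulrn_eq0 (k : fieldType) (n : nat) (p : {mpoly k[n]}) d :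
  [pchar k] =i pred0 -> p *+ d.+1 = 0 -> p = 0.
Proof.
move=> k0 pd; apply/mpolyP => m; rewrite mcoeff0; apply: (@pchar0_mulrn_eq0 _ _ d k0).
by rewrite -mcoeffMn pd mcoeff0.
Qed.

Section Triangularizable.
Variables (k : fieldType) (n : nat) (alpha : 'I_n -> {mpoly k[n]} -> {mpoly k[n]}).
Hypothesis tri : triangularizable alpha.

Lemma triangularizable_det : \det (\matrix_(r, l) alpha r 'X_l) != 0.
Proof.
have [_ _ _ lt0 diag] := tri.
(* The matrix is upper triangular, while [det_trig] expects a lower triangular one. *)
rewrite -det_tr det_trig; last by apply/is_trig_mxP => r l rl; rewrite !mxE lt0.
by under eq_bigr => r _ do rewrite !mxE.
Qed.

(** The hypothesis says that the matrix of the [alpha r 'X_l] kills the gradient of [s]. Multiplying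
    by the adjugate leaves [\det M] times each partial derivative, and [S] is a domain. *)
Lemma triangularizable_kernel s : [pchar k] =i pred0 ->
  (forall r, alpha r s = 0) -> s = (s@_0)%:MP.
Proof.
move=> k0 s0; have [dera _ _ _ _] := tri.
apply: mderiv_eq0_mpolyC => [x d|l]; first exact: pchar0_mulrn_eq0.
pose M := \matrix_(r, l) alpha r 'X_l; pose v := \col_l s^`M(l).
have Mv : M *m v = 0.
  apply/colP => r; rewrite !mxE -[RHS](s0 r) (derivationE (dera r)).
  by apply: eq_bigr => q _; rewrite !mxE.
have := congr1 (mulmx (\adj M)) Mv; rewrite mulmxA mul_adj_mx mul_scalar_mx mulmx0.
move=> /colP/(_ l); rewrite !mxE => /eqP.
by rewrite mulf_eq0 (negPf triangularizable_det) => /eqP.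
Qed.
End Triangularizable.

(** * The center of the enveloping algebra *)

Theorem theorem3p4 (k : fieldType) (n : nat)
    (alpha : 'I_n -> {mpoly k[n]} -> {mpoly k[n]})
    (U : algType k) (i : {mpoly k[n]} -> U)
    (j : ({mpoly k[n]} -> {mpoly k[n]}) -> U) :
  [pchar k] =i pred0 ->
  (0 < n)%N ->
  triangularizable alpha ->
  is_enveloping_algebra alpha i j ->
  forall u : U, (forall v : U, u * v = v * u) <-> exists c : k, u = c%:A.
Proof.
move=> k0 _ tri env u; split=> [uC|[c ->] v]; last by rewrite mulr_algl mulr_algr.
have [[ia jL jB jZ jC] _] := env; have [iL _ i1] := ia.
have [i' iE] := kalg_mor_rmorphism ia; subst i.
have lr := env.1; have [dera brk _ _ _] := tri.
(* The universal property turns the compatible operators on symbols into an action of [U]. *)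
have [[h [ha hi hj]] _] := env.2 _ _ _ (symbols_LR_compatible dera).
have [h' hE] := kalg_mor_rmorphism ha; subst h.
have {}hj r : h' (j (alpha r)) = field_op (alpha r) by apply/hj/in_span_alpha.
have [Q uE] := normal_form_surj lr brk env u.
have {}uE : u = i' Q@_0.
  rewrite uE; apply: (commuting_in_base hi hj (enveloping_ind lr brk env) lr).
  - by move=> x d; apply: mpoly_mulrn_eq0.
  - exact: triangularizable_det.
  - by move=> l; rewrite -uE.
set s := Q@_0 in uE.
have s0 r : alpha r s = 0.
  (* Centrality gives [i' (alpha r s) = 0]; acting on [1] recovers [alpha r s], so it vanishes
     too. *)
  have := jC s _ (in_span_alpha alpha r); rewrite -uE uC subrr => is0.
  have := act_i hi (alpha r s) 1; rewrite -is0 act0 => /(congr1 (mcoeff 0)).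
  by rewrite mcoeff0 mcoeffZ mcoeff1 eqxx mulr1 => <-.
exists s@_0; rewrite uE (triangularizable_kernel tri k0 s0) mcoeffC eqxx mulr1.
have := iL s@_0 1 0; rewrite rmorph0 !addr0 i1 => <-.
by rewrite -mul_mpolyC mulr1.
Qed.
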